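(* Let $\bm X^*$ be a $[0,\infty)^d$-valued regularly varying random vector with index $1$ and spectral vector $\bm\Theta$. Then the spectral measure, i.e. the distribution of $\bm\Theta$, is uniquely determined by the moments $$\left\{\mathbb E[(\bm v^\top\bm\Theta)_+^p]:\ \bm v\in\partial B_1^+(\bm 0),\ p\in\mathbb N\right\}=\left\{\mathbb E[(\bm v^\top\bm\Theta)^p]:\ \bm v\in\partial B_1^+(\bm 0),\ p\in\mathbb N\right\}.$$ That is, if $\bm\Theta$ and $\bm\Theta'$ are the spectral vectors of two such random vectors and $\mathbb E[(\bm v^\top\bm\Theta)^p]=\mathbb E[(\bm v^\top\bm\Theta')^p]$ for all $\bm v\in\partial B_1^+(\bm 0)$ and $p\in\mathbb N$, then $\bm\Theta$ and $\bm\Theta'$ have the same distribution.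
   Context: $\|\cdot\|$ is the maximum norm on $\mathbb R^d$, $x_+=\max(x,0)$, $\mathbb N=\{1,2,\dots\}$, and $\partial B_1^+(\bm 0)=\{\bm v\in[0,\infty)^d:\ \sum_{i=1}^dv_i=1\}$. A $[0,\infty)^d$-valued random vector $\bm X^*$ is regularly varying with index 1 if, as $u\to\infty$, the conditional law of $u^{-1}\bm X^*$ given $\|\bm X^*\|>u$ converges weakly to the law of $Y\bm\Theta$, where $Y$ is unit Pareto ($\mathbb P(Y>y)=y^{-1}$, $y\ge1$), independent of the $[0,\infty)^d$-valued random vector $\bm\Theta$, and $\|\bm\Theta\|=1$ almost surely; $\bm\Theta$ is called the spectral vector and its distribution the spectral measure. *)

(* Defs.v *)
From mathcomp Require Import all_boot all_order all_algebra.
From mathcomp Require Import all_classical all_reals all_analysis.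

Set Implicit Arguments.
Unset Strict Implicit.
Unset Printing Implicit Defensive.

Import Order.TTheory GRing.Theory Num.Theory.
Import numFieldNormedType.Exports.

Local Open Scope classical_set_scope.
Local Open Scope ring_scope.

(* R^d with its Borel sigma-algebra.  As a type this is 'rV[R]_d, whose norm
   `|x| is the maximum norm. *)
Definition borel_rV (R : realType) (d : nat) : measurableType _ :=
  g_sigma_algebraType (@open 'rV[R]_d).

(* Convergence in distribution along a filter F.  Laws are taken as set
   functions so that laws such as that of u^-1 X given {`|X| > u} need no
   measurability proof to be written down. *)
Definition weak_cvg (R : realType) (d : nat) (I : Type) (F : set_system I)
    (mu : I -> set (borel_rV R d) -> \bar R)
    (nu : set (borel_rV R d) -> \bar R) : Prop :=
  forall f : 'rV[R]_d -> R,
    continuous f -> (exists M : R, forall x, `|f x| <= M) ->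
    (\int[mu i]_x (f x)%:E)%E @[i --> F] --> (\int[nu]_x (f x)%:E)%E.

(* P(. | D); meaningful when D is measurable and P D > 0. *)
Definition cond_prob (R : realType) (disp : measure_display)
    (T : measurableType disp) (P : probability T R) (D : set T) :
    set T -> \bar R :=
  fun A => (fine (P (A `&` D)) / fine (P D))%:E.

Definition indep_RV (R : realType) (disp disp1 disp2 : measure_display)
    (T : measurableType disp) (T1 : measurableType disp1)
    (T2 : measurableType disp2) (P : probability T R)
    (X : {RV P >-> T1}) (Y : {RV P >-> T2}) : Prop :=
  forall (A : set T1) (B : set T2), measurable A -> measurable B ->
    P (X @^-1` A `&` Y @^-1` B) = (P (X @^-1` A) * P (Y @^-1` B))%E.

Definition unit_pareto (R : realType) (disp : measure_display)
    (T : measurableType disp) (P : probability T R) (Y : {RV P >-> R}) : Prop :=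
  forall y : R, 1 <= y -> ccdf Y y = (y^-1)%:E.

Definition nonneg_valued (R : realType) (d : nat) (T : Type)
    (X : T -> 'rV[R]_d) : Prop :=
  forall w i, 0 <= X w 0 i.

Definition exceedance (R : realType) (d : nat) (T : Type)
    (X : T -> 'rV[R]_d) (u : R) : set T := [set w | u < `|X w|].

(* X is a [0,oo)^d-valued random vector, regularly varying with index 1, and
   Theta is a spectral vector of X.  X and Theta may live on different
   probability spaces.  The positivity of P(`|X| > u) is what the conditioning
   on {`|X| > u} for u -> oo presupposes: by monotonicity in u, positivity for
   large u is the same as positivity for all u. *)
Definition regularly_varying1 (R : realType) (d : nat)
    (disp disp' : measure_display)
    (T : measurableType disp) (T' : measurableType disp')
    (P : probability T R) (Q : probability T' R)
    (X : {RV P >-> borel_rV R d}) (Theta : {RV Q >-> borel_rV R d}) : Prop :=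
  [/\ nonneg_valued X,
      nonneg_valued Theta,
      {ae Q, forall w, `|Theta w : 'rV[R]_d| = 1},
      forall u : R, (0 < P (exceedance X u))%E &
      exists Y : {RV Q >-> R},
        [/\ unit_pareto Y, indep_RV Y Theta &
            weak_cvg (pinfty_nbhs R)
              (fun u => pushforward (cond_prob P (exceedance X u))
                          (fun w => u^-1 *: (X w : 'rV[R]_d) : borel_rV R d))
              (pushforward Q
                 (fun w => Y w *: (Theta w : 'rV[R]_d) : borel_rV R d))]].

Definition dotv (R : realType) (d : nat) (v x : 'rV[R]_d) : R :=
  \sum_(i < d) v 0 i * x 0 i.

Definition unit_simplex (R : realType) (d : nat) : set 'rV[R]_d :=
  [set v | (forall i, 0 <= v 0 i) /\ \sum_(i < d) v 0 i = 1].

Definition moment (R : realType) (d : nat) (disp : measure_display)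
    (T : measurableType disp) (Q : probability T R)
    (Theta : {RV Q >-> borel_rV R d}) (v : 'rV[R]_d) (p : nat) : \bar R :=
  ('E_Q[(fun w => dotv v (Theta w) ^+ p)%R])%E.

Definition pos_moment (R : realType) (d : nat) (disp : measure_display)
    (T : measurableType disp) (Q : probability T R)
    (Theta : {RV Q >-> borel_rV R d}) (v : 'rV[R]_d) (p : nat) : \bar R :=
  ('E_Q[(fun w => Num.max (dotv v (Theta w)) 0 ^+ p)%R])%E.

(* distribution is a function on all sets; its values are only constrained on
   measurable ones. *)
Definition same_law (R : realType) (d : nat) (disp disp' : measure_display)
    (T : measurableType disp) (T' : measurableType disp')
    (Q : probability T R) (Q' : probability T' R)
    (Theta : {RV Q >-> borel_rV R d}) (Theta' : {RV Q' >-> borel_rV R d}) :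
    Prop :=
  forall A : set (borel_rV R d), measurable A ->
    distribution Q Theta A = distribution Q' Theta' A.

(* Main.v *)
Require Import Defs.
From mathcomp Require Import all_boot all_order all_algebra.
From mathcomp Require Import all_classical all_reals all_analysis.
From mathcomp Require Import measurable_realfun ring lra.

Import Order.TTheory GRing.Theory Num.Theory.
Import numFieldNormedType.Exports.

Local Open Scope classical_set_scope.
Local Open Scope ring_scope.

(** Up to a null event, the spectral vector lies in the unit cube [[0,1]^d]:
    it is nonnegative and its maximum norm is [1]. The equality of the two
    families of moments is then immediate, since [v^T Theta >= 0]. For
    uniqueness, homogeneity extends the hypothesis from the simplex to all
    [v >= 0], and [v^T Theta] is bounded, so that the exponential series can be
    integrated term by term: the Laplace transforms [E exp(- v^T Theta)],
    [v >= 0], of the two spectral vectors coincide ([agree_exp]).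

    That the Laplace transform determines the law is a multiplicative class
    argument ([multiplicative_class_unique]). The functions [exp(- v^T x)] are
    closed under multiplication. Call [g] a multiplier if [f * g] has the same
    two integrals against every exponential as soon as [f] has. Multipliers form
    an algebra that contains the exponentials and is closed under bounded
    pointwise limits. The sign function is a pointwise limit of odd polynomials
    on [[-1,1]], so that the indicator of [{g > 0}] is a multiplier when [g] is
    one ([multiplier_indic_pos]). The sets whose indicator is a multiplier form
    a sigma-algebra ([sigma_algebra_multiplier]); it contains the coordinate
    half-spaces, hence the rational boxes, hence the open sets
    ([borel_rV_halfspaces]). Testing a multiplier against the constant function
    [1] shows that the two laws agree on that sigma-algebra.

    Working with exponentials instead of monomials in the coordinates avoids
    recovering mixed moments from the powers of [v^T Theta] by polarization. *)

(** * Polynomial approximation of the sign function *)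

(** The odd cubic that fixes [-1], [0] and [1] with zero slope at [-1] and [1]:
    [0] repels and the two other fixed points attract, so that its iterates
    converge to the sign on [[-1,1]]. *)
Definition sign_step {R : realType} (t : R) : R := t * (3 - t ^+ 2) / 2.

Lemma sign_step_itv (R : realType) (t : R) : `|t| <= 1 -> `|sign_step t| <= 1.
Proof.
rewrite !ler_norml => /andP[tN1 t1]; apply/andP; split; rewrite -subr_ge0.
  have -> : sign_step t - -1 = (1 + t) ^+ 2 * (2 - t) / 2.
    by rewrite /sign_step; field.
  by apply: divr_ge0 => //; apply: mulr_ge0; [exact: sqr_ge0|lra].
have -> : 1 - sign_step t = (1 - t) ^+ 2 * (2 + t) / 2.
  by rewrite /sign_step; field.
by apply: divr_ge0 => //; apply: mulr_ge0; [exact: sqr_ge0|lra].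
Qed.

Lemma sign_step_iter_itv (R : realType) n (t : R) :
  `|t| <= 1 -> `|iter n sign_step t| <= 1.
Proof. by move=> t1; elim: n => //= n; exact: sign_step_itv. Qed.

Lemma sign_step_iterN (R : realType) n (t : R) :
  iter n sign_step (- t) = - iter n sign_step t.
Proof. by elim: n => //= n ->; rewrite /sign_step; ring. Qed.

(** The error [1 - s] is multiplied at each step by [(1 - s) (2 + s) / 2], which
    decreases in [s]. As the iterates never go below [t], this factor is at most
    its value at [t], and the convergence is geometric. *)
Lemma sign_step_iter_pos (R : realType) n (t : R) : 0 < t -> t <= 1 ->
  t <= iter n sign_step t <= 1 /\
  1 - iter n sign_step t <= ((1 - t) * (2 + t) / 2) ^+ n.
Proof.
move=> t0 t1; elim: n => [|n [/andP[h1 h2] h3]] /=.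
  by rewrite lexx t1 expr0; split => //; lra.
set s := iter n _ t in h1 h2 h3 *.
have s0 : 0 < s by lra.
have ss : s <= sign_step s by rewrite /sign_step; nra.
have s1 : sign_step s <= 1.
  by have := @sign_step_itv _ s; rewrite !ler_norml => /(_ _)/andP[|//]; lra.
split; first by rewrite s1 (le_trans h1 ss).
have -> : 1 - sign_step s = ((1 - s) * (2 + s) / 2) * (1 - s).
  by rewrite /sign_step; field.
have tsq : t ^+ 2 <= s ^+ 2 by rewrite lerXn2r// nnegrE ltW.
rewrite exprS; apply: ler_pM => //; last by rewrite ler_pM2r//; lra.
  by apply: divr_ge0 => //; apply: mulr_ge0; lra.
by rewrite subr_ge0.
Qed.

Lemma cvg_sign_step_iter (R : realType) (t : R) : `|t| <= 1 ->
  iter n sign_step t @[n --> \oo] --> Num.sg t.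
Proof.
have pos (s : R) : 0 < s -> s <= 1 ->
    iter n sign_step s @[n --> \oo] --> (1 : R).
  move=> s0 s1; set q := (1 - s) * (2 + s) / 2.
  have q01 : `|q| < 1.
    by rewrite /q ltr_norml; apply/andP; split; nra.
  apply: (@squeeze_cvgr _ _ _ _ (fun n => 1 - q ^+ n) (fun=> 1)).
  - apply: nearW => n.
    by have [/andP[_ ->] h] := sign_step_iter_pos R n s s0 s1;
      rewrite andbT lerBlDr -lerBlDl.
  - rewrite -[X in _ --> X]subr0; apply: cvgB; first exact: cvg_cst.
    exact: cvg_expr.
  - exact: cvg_cst.
rewrite ler_norml => /andP[t1 t2].
have [t0|t0|->] := ltgtP t 0; last 1 first.
- rewrite sgr0 (_ : (fun n => _) = fun=> 0); first exact: cvg_cst.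
  by apply/funext => n; elim: n => //= n ->; rewrite /sign_step !mul0r.
- rewrite ltr0_sg// -[t]opprK.
  under eq_fun do rewrite sign_step_iterN.
  by apply: cvgN; apply: pos; lra.
- by rewrite gtr0_sg//; exact: pos.
Qed.

(** * A uniqueness theorem for multiplicative classes *)

Section multiplicative_class.
Context {d : measure_display} {T : measurableType d} {R : realType}.
Variables (C : set T) (mC : measurable C).

Definition bounded_mfun (f : T -> R) :=
  measurable_fun C f /\ exists K : R, forall x, C x -> `|f x| <= K.

Lemma bounded_mfun_cst c : bounded_mfun (cst c).
Proof. by split; [exact: measurable_cst | exists `|c|]. Qed.

Lemma bounded_mfunD f g : bounded_mfun f -> bounded_mfun g ->
  bounded_mfun (f \+ g).
Proof.
move=> [mf [K fK]] [mg [L gL]]; split; first exact: measurable_funD.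
exists (K + L) => x Cx; apply: (le_trans (ler_normD _ _)).
by rewrite lerD// ?fK ?gL.
Qed.

Lemma bounded_mfunM f g : bounded_mfun f -> bounded_mfun g ->
  bounded_mfun (f \* g).
Proof.
move=> [mf [K fK]] [mg [L gL]]; split; first exact: measurable_funM.
by exists (K * L) => x Cx; rewrite /= normrM ler_pM// ?fK ?gL.
Qed.

Lemma bounded_mfun_lim (f_ : nat -> T -> R) f (K : R) :
  (forall n, measurable_fun C (f_ n)) ->
  (forall n x, C x -> `|f_ n x| <= K) ->
  (forall x, C x -> f_ n x @[n --> \oo] --> f x) -> bounded_mfun f.
Proof.
move=> mf fK ff; split; first exact: measurable_fun_cvg ff.
exists K => x Cx; apply: (cvgr_to_le (cvg_norm (ff x Cx))).
by apply: nearW => n; exact: fK.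
Qed.

Variables mu nu : {finite_measure set T -> \bar R}.

Lemma bounded_mfun_integrable (m : {finite_measure set T -> \bar R}) f :
  bounded_mfun f -> m.-integrable C (EFin \o f).
Proof.
move=> [mf [K fK]]; apply: measurable_bounded_integrable => //.
  by rewrite ltey_eq fin_num_measure.
exists K; split; first exact: num_real.
by move=> L KL x /= Cx; rewrite (le_trans (fK x Cx))// ltW.
Qed.

Definition agree (f : T -> R) :=
  (\int[mu]_(x in C) f x = \int[nu]_(x in C) f x)%R.

Lemma agree_ext f g : (forall x, C x -> f x = g x) -> agree f -> agree g.
Proof.
move=> fg; rewrite /agree.
have efg : {in C, f =1 g} by move=> x /set_mem; exact: fg.
by rewrite (eq_Rintegral mu efg) (eq_Rintegral nu efg).
Qed.

Lemma agreeD f g : bounded_mfun f -> bounded_mfun g ->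
  agree f -> agree g -> agree (f \+ g).
Proof.
move=> bf bg; rewrite /agree => af ag.
by rewrite !RintegralD ?af ?ag//; exact: bounded_mfun_integrable.
Qed.

Lemma agreeZ c f : bounded_mfun f -> agree f -> agree (fun x => c * f x).
Proof.
move=> bf; rewrite /agree => af.
by rewrite !RintegralZl ?af//; exact: bounded_mfun_integrable.
Qed.

Lemma agree_lim (f_ : nat -> T -> R) f (K : R) :
  (forall n, measurable_fun C (f_ n)) ->
  (forall n x, C x -> `|f_ n x| <= K) ->
  (forall x, C x -> f_ n x @[n --> \oo] --> f x) ->
  (forall n, agree (f_ n)) -> agree f.
Proof.
move=> mf fK ff af.
have bf := bounded_mfun_lim f_ f K mf fK ff.
have lim (m : {finite_measure set T -> \bar R}) :
    (\int[m]_(x in C) f_ n x)%R @[n --> \oo] --> (\int[m]_(x in C) f x)%R.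
  apply: fine_cvg; rewrite fineK; last first.
    by apply: integrable_fin_num => //; exact: bounded_mfun_integrable.
  apply: (@dominated_cvg _ _ _ _ _ mC (fun n => EFin \o f_ n) _ (cst K%:E)) => //.
  - by move=> n; exact/measurable_EFinP.
  - by move=> x Cx; apply: cvg_EFin; [exact: nearW | exact: ff].
  - by apply: finite_measure_integrable_cst.
rewrite /agree; apply: (cvg_unique (@Rhausdorff R) (lim mu)).
by rewrite (_ : (fun n => _) = (fun n => \int[nu]_(x in C) f_ n x)%R);
  [exact: lim|apply/funext => n; exact: af].
Qed.

Variable E : set (T -> R).
Hypothesis E1 : E (cst 1).
Hypothesis EM : forall e1 e2, E e1 -> E e2 -> E (e1 \* e2).
Hypothesis Em : forall e, E e -> measurable_fun setT e.
Hypothesis Eb : forall e, E e -> exists K : R, forall x, C x -> `|e x| <= K.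
Hypothesis Ea : forall e, E e -> agree e.

Let Ebm e : E e -> bounded_mfun e.
Proof.
by move=> Ee; split; [apply: measurable_funTS; exact: Em|exact: Eb].
Qed.

(** Quantifying over [f] makes products of multipliers multipliers, which the
    bare equality of integrals would not give; testing against all of [E] makes
    the elements of [E] themselves multipliers, because [E] is multiplicative. *)
Definition multiplier (g : T -> R) :=
  bounded_mfun g /\ forall f, bounded_mfun f ->
    (forall e, E e -> agree (f \* e)) -> forall e, E e -> agree (f \* g \* e).

Lemma multiplier_agree g : multiplier g -> agree g.
Proof.
move=> [_ mg]; apply: (agree_ext (cst 1 \* g \* cst 1)) => [x _|].
  by rewrite /= mul1r mulr1.
apply: mg => // [|e Ee]; first exact: bounded_mfun_cst.
by apply: (agree_ext e) => [x _|]; [rewrite /= mul1r|exact: Ea].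
Qed.

Lemma multiplier_cst c : multiplier (cst c).
Proof.
split=> [|f bf fE e Ee]; first exact: bounded_mfun_cst.
apply: (agree_ext (fun x => c * (f x * e x))) => [x _ /=|]; first by ring.
by apply: agreeZ; [apply: bounded_mfunM => //; exact: Ebm|exact: fE].
Qed.

Lemma multiplier_gen e : E e -> multiplier e.
Proof.
move=> Ee; split=> [|f bf fE e' Ee']; first exact: Ebm.
apply: (agree_ext (f \* (e \* e'))) => [x _ /=|]; first by rewrite mulrA.
by apply: fE; exact: EM.
Qed.

Lemma multiplierD g h : multiplier g -> multiplier h -> multiplier (g \+ h).
Proof.
move=> [bg mg] [bh mh]; split=> [|f bf fE e Ee]; first exact: bounded_mfunD.
have be := Ebm e Ee.
apply: (agree_ext ((f \* g \* e) \+ (f \* h \* e))) => [x _ /=|]; first by ring.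
by apply: agreeD; [do 2 apply: bounded_mfunM => //..|exact: mg|exact: mh].
Qed.

Lemma multiplierM g h : multiplier g -> multiplier h -> multiplier (g \* h).
Proof.
move=> [bg mg] [bh mh]; split=> [|f bf fE e Ee]; first exact: bounded_mfunM.
apply: (agree_ext ((f \* g) \* h \* e)) => [x _ /=|]; first by ring.
by apply: mh => //; [exact: bounded_mfunM | exact: mg].
Qed.

Lemma multiplier_ext f g : (forall x, f x = g x) -> multiplier f ->
  multiplier g.
Proof. by move=> /funext ->. Qed.

Lemma multiplier_lim (g_ : nat -> T -> R) g (K : R) :
  (forall n, multiplier (g_ n)) ->
  (forall n x, C x -> `|g_ n x| <= K) ->
  (forall x, C x -> g_ n x @[n --> \oo] --> g x) -> multiplier g.
Proof.
move=> mg gK gg.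
have mg_ n : measurable_fun C (g_ n) by have [[]] := mg n.
split=> [|f bf fE e Ee]; first exact: (bounded_mfun_lim g_ g K).
have [mf [L fL]] := bf; have [me [M eM]] := Ebm e Ee.
apply: (agree_lim (fun n => f \* g_ n \* e) _ (L * K * M)).
- by move=> n; do 2 apply: measurable_funM => //.
- by move=> n x Cx; rewrite /= !normrM !ler_pM ?mulr_ge0// ?fL ?gK ?eM.
- move=> x Cx; apply: cvgM; last exact: cvg_cst.
  by apply: cvgM; [exact: cvg_cst|exact: gg].
- by move=> n; have [_] := mg n; exact.
Qed.

(** After scaling [g] into [[-1,1]], which does not change its sign, [sg g] is
    the bounded limit of polynomials in [g]. *)
Lemma multiplier_sg g : multiplier g -> multiplier (fun x => Num.sg (g x)).
Proof.
move=> mg; have [[_ [K gK]] _] := mg.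
pose c := (`|K| + 1)^-1.
have c0 : 0 < c by rewrite invr_gt0 ltr_wpDl.
have cg x : C x -> `|c * g x| <= 1.
  move=> Cx; rewrite normrM gtr0_norm// /c mulrC ler_pdivrMr ?ltr_wpDl//.
  by rewrite mul1r (le_trans (gK x Cx))// (le_trans (ler_norm _))// lerDl.
apply: (multiplier_lim (fun n x => iter n sign_step (c * g x)) _ 1).
- elim=> [|n IH] /=; first by apply: multiplierM => //; exact: multiplier_cst.
  set h := fun x => iter n _ _ in IH.
  apply: (multiplier_ext (cst 2^-1 \* (h \* (cst 3 \+ cst (-1) \* (h \* h))))).
    by move=> x; rewrite /= /sign_step /h; ring.
  by do ?[exact: multiplier_cst|exact: IH|apply: multiplierM|apply: multiplierD].
- by move=> n x Cx; exact/sign_step_iter_itv/cg.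
- move=> x Cx; rewrite -[Num.sg (g x)](_ : Num.sg (c * g x) = _).
    exact/cvg_sign_step_iter/cg.
  by rewrite sgrM (gtr0_sg c0) mul1r.
Qed.

Lemma multiplier_indic_pos g : multiplier g ->
  multiplier (\1_[set x | 0 < g x]).
Proof.
move=> /multiplier_sg; set s := fun x => _ => ms.
(* (t^2 + t) / 2 maps the signs -1, 0, 1 to 0, 0, 1. *)
apply: (multiplier_ext (cst 2^-1 \* (s \* s \+ s))); last first.
  by do ?[exact: multiplier_cst|exact: ms|apply: multiplierM|apply: multiplierD].
move=> x; rewrite /= /s indicE; have [g0|g0|g0] := ltgtP 0 (g x).
- by rewrite mem_set// gtr0_sg//=; field.
- by rewrite memNset /= ?ltr0_sg//=; [field|rewrite lt_gtF].
- by rewrite memNset /= -?g0 ?sgr0//=; [ring|rewrite ltxx].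
Qed.

(** Complements and finite intersections are polynomial operations on
    indicators; a countable intersection is the bounded limit of finite ones. *)
Lemma sigma_algebra_multiplier :
  sigma_algebra setT [set A | measurable A /\ multiplier \1_A].
Proof.
have mC1 A : multiplier \1_A -> multiplier \1_(~` A).
  move=> mA; apply: (multiplier_ext (cst 1 \+ cst (-1) \* \1_A)).
    move=> x; rewrite /= !indicE in_setC; case: (x \in A) => /=; ring.
  by do ?[exact: multiplier_cst|exact: mA|apply: multiplierM|apply: multiplierD].
split=> [|A [mA iA]|F mF] /=.
- by split=> //; rewrite indic0; exact: multiplier_cst.
- by rewrite setTD; split; [exact: measurableC|exact: mC1].
split; first by apply: bigcupT_measurable => n; have [] := mF n.
rewrite -[\bigcup_k F k]setCK; apply: (mC1); rewrite setC_bigcup.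
apply: (multiplier_lim (fun n => \1_(\bigcap_(k < n) ~` F k)) _ 1).
- elim=> [|n IH].
    by rewrite bigcap_mkord big_ord0 indicT; exact: multiplier_cst.
  rewrite bigcap_mkord big_ord_recr /= -(bigcap_mkord n (fun k => ~` F k)) indicI.
  by apply: multiplierM => //; apply: mC1; have [] := mF n.
- by move=> n x _; rewrite indicE; case: (_ \in _); rewrite ?normr1 ?normr0.
- move=> x _; rewrite !indicE; have [xF|xF] := pselect ((\bigcap_k ~` F k) x).
    rewrite mem_set//; apply: cvg_near_cst; apply: nearW => n.
    by rewrite indicE mem_set// => k _; exact: xF.
  rewrite memNset//.
  have [k Fkx] : exists k, F k x.
    by apply: contrapT => nF; apply: xF => k _ Fk; apply: nF; exists k.
  apply: cvg_near_cst; exists k.+1 => // n /= kn.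
  by rewrite indicE memNset// => /(_ k kn).
Qed.

(** Sub- and superlevel sets of [e] are positivity sets of [b - e] and [e - b],
    so that their indicators are multipliers, and so are the indicators of the
    sets in the sigma-algebra that they generate. A multiplier has the same
    integral over [C] for both measures. *)
Theorem multiplicative_class_unique A :
  <<s [set B | exists2 e, E e & exists b : R,
     B = [set x | e x < b] \/ B = [set x | b < e x]] >> A ->
  mu (A `&` C) = nu (A `&` C).
Proof.
suff gen : [set B | exists2 e, E e & exists b : R,
     B = [set x | e x < b] \/ B = [set x | b < e x]] `<=`
    [set A | measurable A /\ multiplier \1_A].
  move=> /(smallest_sub sigma_algebra_multiplier gen)[mA /multiplier_agree].
  rewrite /agree /Rintegral !integral_indic//.
  move=> /(congr1 (@EFin R)); rewrite !fineK// fin_num_measure//;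
  exact: measurableI.
have pos (g : T -> R) : measurable_fun setT g -> measurable [set x | 0 < g x].
  move=> mg; rewrite -[X in measurable X]setTI.
  rewrite (_ : [set x | 0 < g x] = g @^-1` `]0, +oo[%classic).
    exact: mg.
  by apply/seteqP; split=> x /=; rewrite in_itv/= andbT.
move=> _ [e Ee [b [->|->]]].
- rewrite (_ : [set x | _] = [set x | 0 < (cst b \+ cst (-1) \* e) x]).
    split; last apply: multiplier_indic_pos.
      by apply: pos; apply: measurable_funD => //; apply: measurable_funM => //; exact: Em.
    by do ?[exact: multiplier_cst|exact: multiplier_gen|apply: multiplierM|apply: multiplierD].
  by apply/funext => x; rewrite /= mulN1r subr_gt0.
- rewrite (_ : [set x | _] = [set x | 0 < (cst (- b) \+ e) x]).
    split; last apply: multiplier_indic_pos.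
      by apply: pos; apply: measurable_funD => //; exact: Em.
    by do ?[exact: multiplier_cst|exact: multiplier_gen|apply: multiplierM|apply: multiplierD].
  by apply/funext => x; rewrite /= addrC subr_gt0.
Qed.

End multiplicative_class.
(** * The exponentials generate the Borel sets *)

Section exponential_family.
Context {R : realType} {d : nat}.

Lemma measurable_rV_continuous (f : 'rV[R]_d -> R) :
  continuous f -> measurable_fun setT (f : borel_rV R d -> R).
Proof.
move=> cf; apply: (measurability _ (RGenOpens.measurableE R)).
move=> _ [U [a [b ->]] <-]; rewrite setTI; apply: sub_sigma_algebra.
by apply: open_comp => // x _; exact: cf.
Qed.

Lemma measurable_rV_coord (i : 'I_d) :
  measurable_fun setT (fun x : borel_rV R d => (x : 'rV[R]_d) 0 i).
Proof. by apply: measurable_rV_continuous; exact: coord_continuous. Qed.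

Lemma measurable_dotv (v : 'rV[R]_d) :
  measurable_fun setT (dotv v : borel_rV R d -> R).
Proof.
apply: measurable_sum => i; apply: measurable_funM => //.
exact: measurable_rV_coord.
Qed.

Definition unit_cube : set (borel_rV R d) :=
  [set x | forall i, 0 <= (x : 'rV[R]_d) 0 i <= 1].

Lemma measurable_unit_cube : measurable unit_cube.
Proof.
rewrite (_ : unit_cube = \bigcap_(i : 'I_d)
    ((fun x : borel_rV R d => (x : 'rV[R]_d) 0 i) @^-1` `[0, 1]%classic)).
  apply: fin_bigcap_measurable => // i _.
  by rewrite -[X in measurable X]setTI; exact: measurable_rV_coord.
by apply/seteqP; split=> x /= h i; [move=> _|]; move: (h i); rewrite /= in_itv/=; auto.
Qed.

Definition nonneg_rV : set 'rV[R]_d := [set v | forall i, 0 <= v 0 i].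

Lemma dotv_itv v x : nonneg_rV v -> unit_cube x ->
  0 <= dotv v x <= \sum_(i < d) v 0 i.
Proof.
move=> v0 x01; apply/andP; split.
  by apply: sumr_ge0 => i _; apply: mulr_ge0 => //; have /andP[] := x01 i.
apply: ler_sum => i _; rewrite ler_piMr//.
by have /andP[] := x01 i.
Qed.

Definition exp_family : set (borel_rV R d -> R) :=
  [set e | exists2 v : 'rV[R]_d, nonneg_rV v & e = (fun x => expR (- dotv v x))].

Lemma dotvDl (v w x : 'rV[R]_d) : dotv (v + w) x = dotv v x + dotv w x.
Proof.
by rewrite /dotv -big_split; apply: eq_bigr => i _; rewrite mxE mulrDl.
Qed.

Lemma dotvZl (c : R) (v x : 'rV[R]_d) : dotv (c *: v) x = c * dotv v x.
Proof.
by rewrite /dotv mulr_sumr; apply: eq_bigr => i _; rewrite mxE mulrA.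
Qed.

Lemma dotv_delta i (x : 'rV[R]_d) : dotv (delta_mx 0 i) x = x 0 i.
Proof.
rewrite /dotv (bigD1 i)//= big1 ?addr0 => [|j ji]; rewrite mxE ?eqxx ?mul1r//.
by rewrite (negbTE ji) mul0r.
Qed.

Lemma exp_family1 : exp_family (cst 1).
Proof.
exists 0 => [i|]; first by rewrite mxE.
apply/funext => x; rewrite -[0](scale0r (0 : 'rV[R]_d)) dotvZl.
by rewrite mul0r oppr0 expR0.
Qed.

Lemma exp_familyM e1 e2 : exp_family e1 -> exp_family e2 ->
  exp_family (e1 \* e2).
Proof.
move=> [v v0 ->] [w w0 ->]; exists (v + w) => [i|].
  by rewrite mxE addr_ge0.
by apply/funext => x; rewrite dotvDl opprD expRD.
Qed.

Lemma measurable_exp_family e : exp_family e -> measurable_fun setT e.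
Proof.
move=> [v _ ->]; apply: measurableT_comp; first exact: measurable_expR.
apply: measurableT_comp; [exact: oppr_measurable|exact: measurable_dotv].
Qed.

Lemma exp_family_bounded e : exp_family e ->
  exists K : R, forall x, unit_cube x -> `|e x| <= K.
Proof.
move=> [v v0 ->]; exists 1 => x x01; rewrite ger0_norm ?expR_ge0//.
by rewrite expR_le1 oppr_le0; have /andP[] := dotv_itv v x v0 x01.
Qed.

(** The exponential being monotone, these are the open half-spaces with normal
    vector [v >= 0], together with the trivial sets that come from [v = 0] or
    from [b <= 0]. *)
Let exp_halfspaces : set (set (borel_rV R d)) :=
  [set B | exists2 e, exp_family e & exists b : R,
     B = [set x | e x < b] \/ B = [set x | b < e x]].

Lemma halfspace_gt i a : exp_halfspaces [set x : borel_rV R d | a < (x : 'rV[R]_d) 0 i].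
Proof.
exists (fun x => expR (- dotv (delta_mx 0 i) x)).
  by exists (delta_mx 0 i) => // j; rewrite mxE; case: (_ && _).
exists (expR (- a)); left; apply/seteqP.
by split=> x /=; rewrite dotv_delta ltr_expR ltrN2.
Qed.

Lemma halfspace_lt i a : exp_halfspaces [set x : borel_rV R d | (x : 'rV[R]_d) 0 i < a].
Proof.
exists (fun x => expR (- dotv (delta_mx 0 i) x)).
  by exists (delta_mx 0 i) => // j; rewrite mxE; case: (_ && _).
exists (expR (- a)); right; apply/seteqP.
by split=> x /=; rewrite dotv_delta ltr_expR ltrN2.
Qed.

(** An open set is the union of the open boxes with rational corners that it
    contains. There are countably many of them, and each is a finite
    intersection of coordinate half-spaces. *)
Lemma borel_rV_halfspaces A : measurable A -> <<s exp_halfspaces >> A.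
Proof.
apply: smallest_sub; first exact: smallest_sigma_algebra.
move=> U oU.
pose box (p : 'rV[rat]_d * 'rV[rat]_d) : set 'rV[R]_d :=
  [set x | forall i, ratr (p.1 0 i) < x 0 i /\ x 0 i < ratr (p.2 0 i)].
pose HT : measurableType _ := g_sigma_algebraType exp_halfspaces.
have mbox p : (@measurable _ HT) (box p).
  rewrite (_ : box p = \bigcap_(i : 'I_d)
    ([set x | ratr (p.1 0 i) < x 0 i] `&` [set x | x 0 i < ratr (p.2 0 i)])).
    apply: fin_bigcap_measurable => // i _.
    by apply: measurableI; apply: sub_sigma_algebra;
      [exact: halfspace_gt|exact: halfspace_lt].
  by apply/seteqP; split=> x /= h i; [move=> _; exact: h|exact: (h i I)].
(* A box that is not contained in U contributes the empty set. *)
rewrite (_ : U = \bigcup_p (box p `&` [set x | box p `<=` U])).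
  apply: (@countable_bigcupT_measurable _ HT); first exact: countableP.
  move=> p.
  have [pU|pU] := pselect (box p `<=` U).
    suff -> : [set _ : 'rV[R]_d | box p `<=` U] = setT by rewrite setIT; exact: mbox.
    by apply/seteqP; split.
  suff -> : [set _ : 'rV[R]_d | box p `<=` U] = set0 by rewrite setI0; exact: measurable0.
  by apply/seteqP; split.
apply/seteqP; split=> [x Ux|x [p _ [px]]]; last exact.
have /nbhs_ballP[e /= e0 eU] : nbhs x U by exact: open_nbhs_nbhs.
have approx (y z : R) : exists q : rat, y < z -> y < ratr q < z.
  have [yz|_] := ltP y z; last by exists 0.
  by have [q] := rat_in_itvoo yz; rewrite in_itv; exists q.
have [l lP] : {l : 'rV[rat]_d | forall i, x 0 i - e < ratr (l 0 i) < x 0 i}.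
  exists (\row_i projT1 (cid (approx (x 0 i - e) (x 0 i)))) => i.
  by rewrite mxE; case: cid => q /= qP; apply: qP; rewrite ltrBlDr ltrDl.
have [r rP] : {r : 'rV[rat]_d | forall i, x 0 i < ratr (r 0 i) < x 0 i + e}.
  exists (\row_i projT1 (cid (approx (x 0 i) (x 0 i + e)))) => i.
  by rewrite mxE; case: cid => q /= qP; apply: qP; rewrite ltrDl.
exists (l, r) => //; split=> [i /=|].
  by have /andP[_ ->] := lP i; have /andP[-> _] := rP i.
move=> y /= yb; apply: eU; split=> // j i; rewrite (ord1 j).
have /andP[? ?] := lP i; have /andP[? ?] := rP i; have [? ?] := yb i.
by rewrite /ball/= ltr_norml; apply/andP; split; lra.
Qed.

End exponential_family.

(** * From the moments to the law *)

Section moments.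
Context {R : realType} {d : nat}.
Variables mu nu : probability (borel_rV R d) R.
Hypothesis moments : forall (v : 'rV[R]_d) (p : nat), unit_simplex v -> (0 < p)%N ->
  agree unit_cube mu nu (fun x => dotv v x ^+ p).
Hypothesis cube : mu unit_cube = nu unit_cube.

Lemma bounded_dotvX (v : 'rV[R]_d) p : nonneg_rV v ->
  bounded_mfun unit_cube (fun x => dotv v x ^+ p).
Proof.
move=> v0; split.
  by apply: measurable_funTS; apply: measurable_funX; exact: measurable_dotv.
exists ((\sum_(i < d) v 0 i) ^+ p) => x /(dotv_itv _ _ v0)/andP[h1 h2].
by rewrite ger0_norm ?exprn_ge0// lerXn2r// nnegrE// (le_trans h1 h2).
Qed.

(** A nonzero [v >= 0] is the sum of its coordinates times a point of the
    simplex. The power [0] needs the total masses. *)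
Lemma agree_dotvX (v : 'rV[R]_d) p : nonneg_rV v ->
  agree unit_cube mu nu (fun x => dotv v x ^+ p).
Proof.
have mC := @measurable_unit_cube R d.
move=> v0; have [->|p0] := eqVneq p 0%N.
  rewrite /agree; under eq_Rintegral do rewrite expr0.
  under [RHS]eq_Rintegral do rewrite expr0.
  by rewrite !Rintegral_cst//; congr (_ * fine _).
have [s0|s0] := eqVneq (\sum_(i < d) v 0 i) 0.
  have d0 x : dotv v x = 0.
    rewrite /dotv big1// => i _.
    by rewrite (psumr_eq0P _ s0)// ?mul0r// => j _; exact: v0.
  apply: (agree_ext _ _ _ (cst 0)).
    by move=> x _; rewrite d0 expr0n (negbTE p0).
  by rewrite /agree !Rintegral_cst// !mul0r.
have s_gt0 : 0 < \sum_(i < d) v 0 i by rewrite lt_neqAle eq_sym s0 sumr_ge0.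
set s := \sum_(i < d) v 0 i in s0 s_gt0.
have w0 : nonneg_rV (s^-1 *: v).
  by move=> i; rewrite mxE mulr_ge0// invr_ge0 ltW.
apply: (agree_ext _ _ _ (fun x : borel_rV R d => s ^+ p * dotv (s^-1 *: v) x ^+ p)).
  by move=> x _; rewrite dotvZl -exprMn mulrA divff// mul1r.
apply: agreeZ => //; first exact: bounded_dotvX.
apply: moments; last by rewrite lt0n.
by split=> //; under eq_bigr do rewrite mxE; rewrite -mulr_sumr mulVf.
Qed.

(** The partial sums of the exponential series at [- v^T x] are linear
    combinations of powers of [v^T x], and on the cube they are dominated by
    [exp (v_1 + ... + v_d)]. *)
Lemma agree_exp e : exp_family e -> agree unit_cube mu nu e.
Proof.
have mC := @measurable_unit_cube R d.
move=> [v v0 ->].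
pose S n (x : borel_rV R d) := series (exp_coeff (- dotv v x)) n.
have SE n x : S n x = \sum_(0 <= k < n) ((-1) ^+ k / k`!%:R) * dotv v x ^+ k.
  by apply: eq_bigr => k _; rewrite /exp_coeff /= (exprNn (dotv v x)) mulrAC.
have bS n : bounded_mfun unit_cube (S n) /\ agree unit_cube mu nu (S n).
  elim: n => [|n [bS aS]].
    rewrite (_ : S 0%N = cst 0).
      split; first exact: bounded_mfun_cst.
      by rewrite /agree !Rintegral_cst// !mul0r.
    by apply/funext => x; rewrite SE big_nil.
  rewrite (_ : S n.+1 = S n \+ (cst ((-1) ^+ n / n`!%:R) \* (fun x => dotv v x ^+ n))).
    have bd := bounded_dotvX v n v0.
    have bc := bounded_mfunM _ _ _ (bounded_mfun_cst unit_cube ((-1) ^+ n / n`!%:R)) bd.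
    split; first exact: bounded_mfunD.
    apply: agreeD => //; apply: agreeZ => //; exact: agree_dotvX.
  by apply/funext => x; rewrite /= !SE big_nat_recr.
apply: (agree_lim _ mC mu nu S _ (expR (\sum_(i < d) v 0 i))).
- by move=> n; have [[]] := bS n.
- move=> n x /(dotv_itv _ _ v0)/andP[h1 h2].
  apply: (@le_trans _ _ (series (exp_coeff (dotv v x)) n)).
    apply: (le_trans (ler_norm_sum _ _ _)); apply: ler_sum => k _.
    by rewrite /exp_coeff /= normrM normrX normrN (ger0_norm h1) ger0_norm.
  apply: (@le_trans _ _ (expR (dotv v x))); last by rewrite ler_expR.
  apply: nondecreasing_cvgn_le; last exact: is_cvg_series_exp_coeff.
  by apply/nondecreasing_seqP => k; rewrite seriesEnat/= big_nat_recr//= lerDl exp_coeff_ge0.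
- by move=> x _; exact: is_cvg_series_exp_coeff.
- by move=> n; have [] := bS n.
Qed.

Lemma moments_unique A : measurable A ->
  mu (A `&` unit_cube) = nu (A `&` unit_cube).
Proof.
move=> mA.
apply: (multiplicative_class_unique _ (@measurable_unit_cube R d) mu nu exp_family).
- exact: exp_family1.
- exact: exp_familyM.
- exact: measurable_exp_family.
- exact: exp_family_bounded.
- exact: agree_exp.
- exact: borel_rV_halfspaces.
Qed.

End moments.

Section unit_norm_vectors.
Context {R : realType} {d : nat} {disp : measure_display}.
Context {T : measurableType disp}.
Variables (Q : probability T R) (Theta : {RV Q >-> borel_rV R d}).
Hypothesis Theta_ge0 : nonneg_valued Theta.
Hypothesis Theta1 : {ae Q, forall w, `|Theta w : 'rV[R]_d| = 1}.

Lemma norm1_unit_cube (x : 'rV[R]_d) : nonneg_rV x -> `|x| = 1 -> unit_cube x.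
Proof.
move=> x0 x1 i; rewrite x0 -x1 -[x 0 i]ger0_norm//=.
rewrite [leRHS]/Num.norm/= mx_normrE.
exact: (@le_bigmax _ _ _ 0 (fun ij => `|x ij.1 ij.2|) (0, i)).
Qed.

Lemma distribution_outside_cube : distribution Q Theta (~` unit_cube) = 0.
Proof.
have mC := @measurable_unit_cube R d.
rewrite /distribution/pushforward; apply/negligibleP.
  by apply: measurable_funPTI; exact: measurableC.
apply: negligibleS Theta1 => w /= nC t1; apply: nC.
by apply: norm1_unit_cube => // i; exact: Theta_ge0.
Qed.

Lemma distribution_cube A : measurable A ->
  distribution Q Theta A = distribution Q Theta (A `&` unit_cube).
Proof.
have mC := @measurable_unit_cube R d.
move=> mA; rewrite (measureDI _ mA mC).
rewrite [X in (X + _)%E](_ : _ = 0)%E ?add0e//.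
apply: (subset_measure0 _ _ _ distribution_outside_cube).
- exact: measurableD.
- exact: measurableC.
- by move=> x [].
Qed.

(** The moments only see the trace of the law of [Theta] on the cube, so that the
    theory of bounded functions applies to them. *)
Lemma moment_cube (v : 'rV[R]_d) p : nonneg_rV v ->
  moment Theta v p =
  (\int[distribution Q Theta]_(x in unit_cube) (dotv v x ^+ p)%:E)%E.
Proof.
have mC := @measurable_unit_cube R d.
move=> v0; rewrite /moment unlock.
(* The absolute value makes the integrand nonnegative on the whole space, not
   only on the range of Theta, so that the change of variables needs no
   integrability. *)
pose f (x : borel_rV R d) : \bar R := `|dotv v x ^+ p|%:E.
have mf : measurable_fun setT f.
  apply/measurable_EFinP; apply: measurableT_comp => //.
  by apply: measurable_funX; exact: measurable_dotv.
transitivity (\int[Q]_(w in Theta @^-1` setT) (f \o Theta) w)%E.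
  rewrite preimage_setT; apply: eq_integral => w _; rewrite /f/= ger0_norm//.
  apply: exprn_ge0; apply: sumr_ge0 => i _.
  by apply: mulr_ge0; [exact: v0|exact: Theta_ge0].
rewrite -(ge0_integral_pushforward (measurable_funPT Theta))//; last first.
  by move=> x _; rewrite lee_fin.
rewrite -(setUv unit_cube) integral_setU//; last 3 first.
- exact: measurableC.
- by rewrite setUv.
- exact/disj_setPCl.
rewrite [X in (_ + X)%E]null_set_integral ?adde0//.
- apply: eq_integral => x /set_mem x01; rewrite /f ger0_norm//.
  by apply: exprn_ge0; have /andP[] := dotv_itv v x v0 x01.
- exact: measurableC.
- exact: measurable_funTS.
- exact: distribution_outside_cube.
Qed.

End unit_norm_vectors.

Theorem proposition3 (R : realType) (d : nat)
    (d1 d2 e1 e2 : measure_display)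
    (T1 : measurableType d1) (T2 : measurableType d2)
    (S1 : measurableType e1) (S2 : measurableType e2)
    (P1 : probability T1 R) (P2 : probability T2 R)
    (Q1 : probability S1 R) (Q2 : probability S2 R)
    (X : {RV P1 >-> borel_rV R d}) (Theta : {RV Q1 >-> borel_rV R d})
    (X' : {RV P2 >-> borel_rV R d}) (Theta' : {RV Q2 >-> borel_rV R d}) :
  regularly_varying1 X Theta -> regularly_varying1 X' Theta' ->
  (forall (v : 'rV[R]_d) (p : nat), unit_simplex v -> (0 < p)%N ->
     pos_moment Theta v p = moment Theta v p) /\
  ((forall (v : 'rV[R]_d) (p : nat), unit_simplex v -> (0 < p)%N ->
      moment Theta v p = moment Theta' v p) ->
   same_law Theta Theta').
Proof.
move=> [_ Theta_ge0 Theta1 _ _] [_ Theta'_ge0 Theta'1 _ _]; split.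
  move=> v p [v0 _] _; rewrite /pos_moment /moment; congr ('E_Q1[_])%E.
  apply/funext => w; rewrite max_l//.
  by apply: sumr_ge0 => i _; apply: mulr_ge0; [exact: v0|exact: Theta_ge0].
move=> moments A mA.
rewrite (distribution_cube _ _ Theta_ge0 Theta1)//.
rewrite (distribution_cube _ _ Theta'_ge0 Theta'1)//.
apply: moments_unique => // [v p vS p0|]; last first.
  have := distribution_cube _ _ Theta_ge0 Theta1 setT measurableT.
  have := distribution_cube _ _ Theta'_ge0 Theta'1 setT measurableT.
  by rewrite !setTI !probability_setT => Theta'C ThetaC; rewrite -[LHS]ThetaC.
have [v0 _] := vS.
by rewrite /agree /Rintegral -!moment_cube ?moments.
Qed.
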